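(* Let $H$ be a graph with vertex set $V(H)=\{v_1,\dots,v_{n(H)}\}$, let $\mathcal{X}=\{X_i:1\le i\le n(H)\}$ be a family of graphs, each with at least one vertex, and let $G=H\circ\mathcal{X}$. Let $F=\{v_i\in V(H):\mu(X_i)=\mu(v_i\circ X_i)\}$. Then: (i) $\alpha(G)=\sum_{i=1}^{n(H)}\alpha(X_i)$; (ii) $\mu(G)=\mu(H[F])+\sum_{i=1}^{n(H)}\mu(v_i\circ X_i)$; (iii) $\sum_{i=1}^{n(H)}\mu(v_i\circ X_i)=\sum_{i=1}^{n(H)}\mu(X_i)+|V(H)-F|$.
   Context: All graphs are finite, simple and undirected. $n(G)$ is the number of vertices of $G$, $\alpha(G)$ is the maximum size of an independent set of $G$, and $\mu(G)$ is the maximum size of a matching of $G$. For $S\subseteq V(H)$, $H[S]$ is the induced subgraph. The corona $H\circ\mathcal{X}$ is the graph obtained from the disjoint union of $H$ and $X_1,\dots,X_{n(H)}$ by joining each vertex $v_i$ of $H$ to all vertices of $X_i$. For a vertex $v$ and a graph $X$, $v\circ X$ denotes $K_1\circ X$, i.e., $X$ together with a new vertex $v$ adjacent to all vertices of $X$. *)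

(* Defs.v *)
From HB Require Import structures.
From mathcomp Require Import all_boot.

Set Implicit Arguments.
Unset Strict Implicit.
Unset Printing Implicit Defensive.

Record sgraph := SGraph {
  vertex :> finType;
  adj : rel vertex;
  adj_sym : symmetric adj;
  adj_irr : irreflexive adj }.

Arguments adj {s} _ _.

Definition independent (G : sgraph) (S : {set G}) : bool :=
  [forall x in S, forall y in S, ~~ adj x y].

Definition alpha (G : sgraph) : nat :=
  \max_(S : {set G} | independent S) #|S|.

Definition edges (G : sgraph) : {set {set G}} :=
  [set [set p.1; p.2] | p : G * G & adj p.1 p.2].

Definition matching (G : sgraph) (M : {set {set G}}) : bool :=
  (M \subset edges G) && trivIset M.

Definition mu (G : sgraph) : nat :=
  \max_(M : {set {set G}} | matching M) #|M|.

Section Induced.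
Variables (G : sgraph) (S : {set G}).

Definition induced_adj : rel {x : G | x \in S} :=
  fun x y => adj (val x) (val y).

Lemma induced_adj_sym : symmetric induced_adj.
Proof. by move=> x y; apply: adj_sym. Qed.

Lemma induced_adj_irr : irreflexive induced_adj.
Proof. by move=> x; apply: adj_irr. Qed.

Definition induced : sgraph := SGraph induced_adj_sym induced_adj_irr.
End Induced.

(* The vertices of the corona are inl v with v a vertex of H, and              *)
(* inr (Tagged _ x) with x a vertex of the copy X v attached to v.             *)
Section Corona.
Variables (H : sgraph) (X : H -> sgraph).

Definition corona_adj : rel (H + {v : H & X v}) := fun a b =>
  match a, b with
  | inl u, inl v => adj u v
  | inl u, inr y => u == tag y
  | inr x, inl v => tag x == v
  | inr x, inr y => (tag x == tag y) && adj (tagged x) (tagged_as x y)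
  end.

Lemma corona_adj_sym : symmetric corona_adj.
Proof.
move=> [u|[u x]] [v|[v y]] /=; rewrite ?[v == u]eq_sym //; first exact: adj_sym.
case: eqP => //= uv; case: v / uv y => y.
by rewrite !tagged_asE adj_sym.
Qed.

Lemma corona_adj_irr : irreflexive corona_adj.
Proof. by move=> [u|[u x]] /=; rewrite ?tagged_asE adj_irr ?andbF. Qed.

Definition corona : sgraph := SGraph corona_adj_sym corona_adj_irr.
End Corona.

Definition K1 : sgraph :=
  @SGraph unit (fun _ _ => false) (fun _ _ => erefl) (fun _ => erefl).

(* The graph v o X; the name of the new vertex v is immaterial.                *)
Definition cone (X : sgraph) : sgraph := corona (fun _ : K1 => X).

(* Main.v *)
Require Import Defs.
From HB Require Import structures.
From mathcomp Require Import all_boot.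

(** Every edge of the corona lies in [H] or in a single cone [v o X_v].  For the
    lower bound in (ii), the vertices of [F] covered by a matching of [H[F]] can
    be spared by their cones at no cost.  For the upper bound, an edge of a
    matching of [G] inside [H] but not inside [F] has an end [v] outside [F];
    then the cone of [v] can only use a matching of [X_v], which costs one edge,
    and distinct edges are charged to distinct vertices. *)

Set Implicit Arguments.
Unset Strict Implicit.
Unset Printing Implicit Defensive.

(** * Disjoint families of finite sets and counting *)

Section FiniteSets.
Variable T : finType.
Implicit Types (A e : {set T}) (M : {set {set T}}).

Lemma trivIset_meet_eq M e1 e2 x :
  trivIset M -> e1 \in M -> e2 \in M -> x \in e1 -> x \in e2 -> e1 = e2.
Proof.
move=> /trivIsetP tM e1M e2M x1 x2; apply/eqP/negPn/negP => ne.
by have /disjointFr/(_ x1) := tM _ _ e1M e2M ne; rewrite x2.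
Qed.

Lemma subset_setId (U : finType) (B : {set U}) (P : pred U) :
  [set x in B | P x] \subset B.
Proof. by rewrite setIdE subsetIl. Qed.

(** Choosing in each member of [M] a point of [A] is injective, because distinct members are
    disjoint. This is the charging argument used for the upper bounds on matchings. *)
Lemma card_trivIset_meets M A :
  trivIset M -> {in M, forall e, exists2 x, x \in e & x \in A} -> #|M| <= #|A|.
Proof.
(* The choice takes values in [option T], since no default point is at hand; [A] is later compared
   through its image under [Some]. *)
move=> tM meetA; pose f e := [pick x in e :&: A].
have fP e : e \in M -> exists2 x, f e = Some x & x \in e :&: A.
  move=> /meetA[x xe xA]; rewrite /f; case: pickP => [y yP|/(_ x)].
    by exists y.
  by rewrite inE xe xA.
have finj : {in M &, injective f}.
  move=> e1 e2 e1M e2M; have [x -> /setIP[x1 _]] := fP _ e1M.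
  have [y -> /setIP[y2 _]] := fP _ e2M; case=> xy.
  by apply: (trivIset_meet_eq tM e1M e2M x1); rewrite xy.
rewrite -(card_in_imset finj) -(card_imset (mem A) Some_inj).
apply/subset_leq_card/subsetP => _ /imsetP[e eM ->].
by have [x -> /setIP[_ xA]] := fP e eM; apply: imset_f.
Qed.

Lemma leq_card_bigcup (I : finType) (P : I -> {set T}) :
  #|\bigcup_i P i| <= \sum_i #|P i|.
Proof.
elim/big_rec2: _ => [|i n A _ le_An]; first by rewrite cards0.
by apply: leq_trans (leq_card_setU _ _) _; rewrite leq_add2l.
Qed.

End FiniteSets.

(** Used to add the matching of [H[F]], at index [None], to a family indexed by the vertices of
    [H]. *)
Lemma sum_option (I : finType) (F : option I -> nat) :
  \sum_i F i = F None + \sum_(i : I) F (Some i).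
Proof.
rewrite (bigD1 None) //=; congr (_ + _).
rewrite (reindex_omap (Some : I -> option I) id) /=; last by case.
by apply: eq_bigl => i; rewrite eqxx.
Qed.

(** * Matchings and independent sets of a single graph *)

Section Graph.
Variable G : sgraph.
Implicit Types (S e : {set G}) (M : {set {set G}}).

Lemma edgesP e :
  reflect (exists x y, adj x y /\ e = [set x; y]) (e \in edges G).
Proof.
apply: (iffP imsetP) => [[[x y]]|[x [y [xy ->]]]].
  by rewrite inE /= => xy ->; exists x, y.
by exists (x, y); rewrite ?inE.
Qed.

Lemma edge_nonempty e : e \in edges G -> exists x, x \in e.
Proof. by case/edgesP => x [y [_ ->]]; exists x; rewrite set21. Qed.

Lemma matching_edge M e : matching M -> e \in M -> e \in edges G.
Proof. by case/andP => /subsetP sM _ /sM. Qed.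

Lemma matching_trivIset M : matching M -> trivIset M.
Proof. by case/andP. Qed.

Lemma matchingS M M' : M' \subset M -> matching M -> matching M'.
Proof.
move=> sM /andP[sE tM]; apply/andP; split; first exact: subset_trans sE.
exact: trivIsetS tM.
Qed.

Lemma matching0 : matching (set0 : {set {set G}}).
Proof.
rewrite /matching sub0set /=; apply/trivIsetP => e1 e2.
by rewrite inE.
Qed.

Lemma leq_mu M : matching M -> #|M| <= mu G.
Proof. by move=> mM; rewrite /mu; apply: leq_bigmax_cond. Qed.

Lemma mu_witness : exists2 M : {set {set G}}, matching M & #|M| = mu G.
Proof.
have [|M mM eM] := @eq_bigmax_cond _ (mem [pred M | @matching G M])
  (fun M : {set {set G}} => #|M|).
  by apply/card_gt0P; exists set0; apply: matching0.
by exists M => //; rewrite -eM.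
Qed.

Lemma independentP S :
  reflect {in S &, forall x y, ~~ adj x y} (independent S).
Proof.
apply: (iffP forall_inP) => [h x y xS yS|h x xS].
  by move/forall_inP: (h x xS); apply.
by apply/forall_inP => y; apply: h.
Qed.

Lemma leq_alpha S : independent S -> #|S| <= alpha G.
Proof. by move=> iS; rewrite /alpha; apply: leq_bigmax_cond. Qed.

Lemma alpha_witness : exists2 S : {set G}, independent S & #|S| = alpha G.
Proof.
have [|S iS eS] := @eq_bigmax_cond _ (mem [pred S | @independent G S])
  (fun S : {set G} => #|S|).
  by apply/card_gt0P; exists set0; apply/independentP => x y; rewrite inE.
by exists S => //; rewrite -eS.
Qed.

Lemma alpha_gt0 : 0 < #|G| -> 0 < alpha G.
Proof.
case/card_gt0P => x _; rewrite -(cards1 x); apply: leq_alpha.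
by apply/independentP => y z /set1P -> /set1P ->; rewrite adj_irr.
Qed.

(** Matchings living in pairwise disjoint vertex regions [A i] have a matching as their union. *)
Lemma leq_sum_mu (I : finType) (A : I -> {set G}) (P : I -> {set {set G}}) :
    (forall i j x, x \in A i -> x \in A j -> i = j) ->
    (forall i, matching (P i)) -> (forall i, {in P i, forall e, e \subset A i}) ->
  \sum_i #|P i| <= mu G.
Proof.
move=> dA mP sPA.
have same i j e1 e2 x :
    e1 \in P i -> e2 \in P j -> x \in e1 -> x \in e2 -> i = j.
  move=> e1P e2P x1 x2; apply: (dA i j x).
    by apply: (subsetP (sPA _ _ e1P)).
  by apply: (subsetP (sPA _ _ e2P)).
have mU : matching (\bigcup_i P i).
  apply/andP; split.
    apply/subsetP => e /bigcupP[i _ eP]; exact: matching_edge (mP i) eP.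
  apply/trivIsetP => e1 e2 /bigcupP[i _ e1P] /bigcupP[j _ e2P] ne.
  rewrite -setI_eq0; apply/eqP/setP => x; rewrite in_set0; apply/negP.
  case/setIP => x1 x2; have eij := same _ _ _ _ _ e1P e2P x1 x2; subst j.
  case/eqP: ne.
  exact: (trivIset_meet_eq (matching_trivIset (mP i)) e1P e2P x1 x2).
apply: leq_trans (leq_mu mU).
(* No edge is counted twice: an edge has a vertex, and that vertex lies in only one region. *)
rewrite -sum1_card partition_disjoint_bigcup /=; last first.
  move=> i j nij; rewrite -setI_eq0; apply/eqP/setP => e.
  rewrite in_set0; apply/negP => /setIP[ei ej].
  have [x xe] := edge_nonempty (matching_edge (mP i) ei).
  by case/eqP: nij; apply: (same _ _ _ _ _ ei ej xe xe).
by apply: leq_sum => i _; rewrite sum1_card.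
Qed.

End Graph.

(** * Transfer along an embedding as an induced subgraph *)

Section Embedding.
Variables (G' G : sgraph) (f : G' -> G).
Hypothesis f_inj : injective f.
Hypothesis f_adj : forall x y, adj (f x) (f y) = adj x y.

Lemma embed_matching (M : {set {set G'}}) :
  matching M -> matching [set f @: e | e : {set G'} in M].
Proof.
move=> mM; apply/andP; split.
  apply/subsetP => _ /imsetP[e eM ->].
  have /edgesP[x [y [xy ->]]] := matching_edge mM eM.
  by apply/edgesP; exists (f x), (f y); rewrite f_adj imsetU1 imset_set1.
apply/trivIsetP => _ _ /imsetP[e1 e1M ->] /imsetP[e2 e2M ->] ne.
rewrite -setI_eq0; apply/eqP/setP => z; rewrite in_set0; apply/negP.
case/setIP => /imsetP[x x1 ->] /imsetP[y y2 /f_inj xy]; subst y.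
case/eqP: ne.
by rewrite (trivIset_meet_eq (matching_trivIset mM) e1M e2M x1 y2).
Qed.

Lemma mu_embed_witness : exists M : {set {set G}},
  [/\ matching M, #|M| = mu G' & {in M, forall e : {set G}, e \subset f @: [set: G']}].
Proof.
have [M mM eM] := mu_witness G'; exists [set f @: e | e : {set G'} in M].
split; first exact: embed_matching.
  by rewrite card_imset //; apply: imset_inj.
by move=> _ /imsetP[e _ ->]; rewrite imsetS.
Qed.

Lemma mu_embed : mu G' <= mu G.
Proof. by have [M [mM <- _]] := mu_embed_witness; apply: leq_mu. Qed.

(** Pull [M] back along [f]: each edge lies in the image of [f], so it is recovered from its
    preimage, which is an edge because [f] reflects adjacency. *)
Lemma leq_mu_embed (M : {set {set G}}) :
  matching M -> {in M, forall e : {set G}, e \subset f @: [set: G']} -> #|M| <= mu G'.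
Proof.
move=> mM sM.
have preK e : e \in M -> f @: (f @^-1: e) = e.
  move=> /sM /subsetP se; apply/setP => z; apply/imsetP/idP.
    by case=> x; rewrite inE => ? ->.
  by move=> ze; have /imsetP[x _ zx] := se z ze; exists x; rewrite ?inE -?zx.
have pre_inj : {in M &, injective (fun e : {set G} => f @^-1: e)}.
  by move=> e1 e2 e1M e2M eq12; rewrite -(preK _ e1M) eq12 preK.
rewrite -(card_in_imset pre_inj); apply: leq_mu; apply/andP; split.
  apply/subsetP => _ /imsetP[e eM ->].
  have /edgesP[z [t [zt def_e]]] := matching_edge mM eM.
  have /subsetP se := sM _ eM; rewrite {}def_e in se *.
  have /imsetP[x _ def_z] := se z (set21 _ _).
  have /imsetP[y _ def_t] := se t (set22 _ _).
  apply/edgesP; exists x, y; split; first by rewrite -f_adj -def_z -def_t.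
  by apply/setP => w; rewrite !inE def_z def_t !(inj_eq f_inj).
apply/trivIsetP => _ _ /imsetP[e1 e1M ->] /imsetP[e2 e2M ->] ne.
rewrite -setI_eq0; apply/eqP/setP => x; rewrite in_set0; apply/negP.
rewrite !inE => /andP[x1 x2]; case/eqP: ne.
by rewrite (trivIset_meet_eq (matching_trivIset mM) e1M e2M x1 x2).
Qed.

Lemma leq_alpha_embed (S : {set G}) :
  independent S -> S \subset f @: [set: G'] -> #|S| <= alpha G'.
Proof.
move=> /independentP iS /subsetP sS.
have -> : S = f @: (f @^-1: S).
  apply/setP => z; apply/idP/imsetP => [zS|[x]].
    by have /imsetP[x _ zx] := sS z zS; exists x; rewrite ?inE -?zx.
  by rewrite inE => ? ->.
rewrite card_imset //; apply/leq_alpha/independentP => x y.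
by rewrite !inE -f_adj; apply: iS.
Qed.

End Embedding.

(** * Structure of the corona and its independence number *)

Section Corona.
Variables (H : sgraph) (X : H -> sgraph).
Local Notation G := (corona X).

(** The fibres of [home] are the vertex sets of the cones, which partition the corona. *)
Definition home (z : G) : H :=
  match z with inl u => u | inr p => tag p end.

Definition base (u : H) : G := inl u.

Definition leaf (v : H) (x : X v) : G := inr (Tagged X x).

Definition cone_in (v : H) (z : cone (X v)) : G :=
  match z with inl _ => inl v | inr p => leaf (tagged p) end.

Lemma base_inj : injective base. Proof. by move=> u v []. Qed.

Lemma leaf_inj v : injective (@leaf v).
Proof.
move=> x y [] /eqP; rewrite -tag_eqE /tag_eq eqxx /= tagged_asE.
by move/eqP.
Qed.

Lemma leaf_adj v (x y : X v) : adj (leaf x) (leaf y) = adj x y.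
Proof. by rewrite /= eqxx tagged_asE. Qed.

Lemma cone_in_inj v : injective (@cone_in v).
Proof.
move=> [[]|[[] x]] [[]|[[] y]] // /leaf_inj /= xy.
by rewrite xy.
Qed.

Lemma cone_in_adj v (x y : cone (X v)) :
  adj (cone_in x) (cone_in y) = adj x y.
Proof.
case: x => [[]|[[] x]]; case: y => [[]|[[] y]] //=; rewrite ?eqxx ?adj_irr //.
by rewrite !tagged_asE.
Qed.

Lemma cone_inE v z : (z \in @cone_in v @: [set: cone (X v)]) = (home z == v).
Proof.
apply/imsetP/eqP => [[[[]|[[] x]] _ ->] //|<-].
case: z => [u|[u x]] /=; first by exists (inl tt).
by exists (inr (@Tagged K1 tt (fun _ => X u) x)).
Qed.

Lemma leafE v z :
  (z \in @leaf v @: [set: X v]) = (home z == v) && (z != base v).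
Proof.
apply/imsetP/andP => [[x _ ->]|[/eqP <-]]; first by rewrite /= eqxx.
by case: z => [u|[u x]] /=; [rewrite eqxx|exists x].
Qed.

Lemma baseE z : (z \in base @: [set: H]) = (z == base (home z)).
Proof.
by apply/imsetP/eqP => [[u _ ->]|->] //; exists (home z).
Qed.

(** An edge whose ends have different homes can only come from the adjacency of [H]. *)
Lemma corona_edge (e : {set G}) : e \in edges G ->
  (e \subset base @: [set: H]) \/ exists v, {in e, forall z, home z = v}.
Proof.
case/edgesP => a [b [ab ->]].
have [eab|nab] := eqVneq (home a) (home b).
  by right; exists (home a) => z /set2P[->|->].
left; apply/subsetP => z; rewrite baseE.
case: a b ab nab => [u|p] [v|q] //= ab; rewrite ?(eqP ab) ?eqxx //.
  by move=> _ /set2P[] ->.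
by case/andP: ab => ->.
Qed.

(** Distinct copies [X v] are joined by no edge, so maximum independent sets of the copies can be
    united. *)
Lemma alpha_corona_ge : \sum_v alpha (X v) <= alpha G.
Proof.
have /fin_all_exists2[S iS eS] v := alpha_witness (X v).
pose U : {set G} := inr @: [set p : {v : H & X v} | tagged p \in S (tag p)].
have iU : independent U.
  apply/independentP => _ _ /imsetP[[u x] xS ->] /imsetP[[v y] yS ->].
  rewrite !inE /= in xS yS *; apply/negP => /andP[/eqP uv]; subst v.
  rewrite tagged_asE; apply/negP.
  by move/independentP: (iS u); apply.
apply: leq_trans (leq_alpha iU); rewrite card_imset; last by move=> p q [].
rewrite -sum1_card (eq_bigl _ _ (in_set _)) /=.
under eq_bigr => v _ do rewrite -eS -sum1_card.
by rewrite (sig_big_dep predT (fun v x => x \in S v) (fun _ _ => 1)) /=.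
Qed.

(** Cut an independent set along the cones. A part containing the apex [v] is just that apex, and
    counts at most [alpha (X v)] as [X v] is nonempty; any other part lies in the copy of [X v]. *)
Lemma alpha_corona_le :
  (forall v, 0 < #|X v|) -> alpha G <= \sum_v alpha (X v).
Proof.
move=> X_gt0; have [S iS <-] := alpha_witness G.
pose P v := [set z in S | home z == v].
have sSP : S \subset \bigcup_v P v.
  by apply/subsetP => z zS; apply/bigcupP; exists (home z); rewrite ?inE ?zS /=.
apply: leq_trans (subset_leq_card sSP) _.
apply: leq_trans (leq_card_bigcup _) _; apply: leq_sum => v _.
have [vS|vS] := boolP (base v \in S).
  apply: leq_trans (alpha_gt0 (X_gt0 v)); rewrite -(cards1 (base v)).
  apply/subset_leq_card/subsetP => z; rewrite !inE => /andP[zS /eqP zv].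
  have /independentP/(_ _ _ vS zS) := iS.
  by case: z zS zv => [u|p] /= _ ->; rewrite eqxx.
apply: (leq_alpha_embed (@leaf_inj v) (@leaf_adj v)).
  apply/independentP => x y; rewrite !inE => /andP[xS _] /andP[yS _].
  by move/independentP: iS; apply.
apply/subsetP => z; rewrite leafE inE => /andP[zS ->].
by apply: contraNneq vS => <-.
Qed.

End Corona.

(** * Matching number of a cone *)

Section Cone.
Variable X : sgraph.

Local Notation X1 := (fun _ : K1 => X).

Lemma mu_cone_ge : mu X <= mu (cone X).
Proof. exact: (mu_embed (@leaf_inj _ X1 tt) (@leaf_adj _ X1 tt)). Qed.

(** At most one edge of a matching covers the apex [c]; the remaining edges form a matching of
    [X]. *)
Lemma mu_cone_le : mu (cone X) <= (mu X).+1.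
Proof.
have [M mM <-] := mu_witness (cone X).
pose c : cone X := inl tt; pose N := [set e in M | c \in e].
have tN : trivIset N.
  by apply: trivIsetS (matching_trivIset mM); apply: subset_setId.
have N_le1 : #|N| <= 1.
  rewrite -(cards1 c); apply: card_trivIset_meets => // e.
  by rewrite inE => /andP[_ ce]; exists c; rewrite ?set11.
have MN : #|M :\: N| <= mu X.
  apply: (leq_mu_embed (@leaf_inj _ X1 tt) (@leaf_adj _ X1 tt)).
    by apply: matchingS mM; apply: subsetDl.
  move=> e; rewrite !inE => /andP[cNe eM]; apply/subsetP => z ze.
  rewrite leafE; apply/andP; split; first by case: (home z).
  by apply: contraNneq cNe => zc; rewrite eM -[c]zc.
rewrite -(cardsID N M) -add1n leq_add //.
by apply: leq_trans N_le1; apply/subset_leq_card/subsetIr.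
Qed.

Lemma mu_coneE : mu (cone X) = mu X + (mu X != mu (cone X)).
Proof.
have := mu_cone_le; rewrite leq_eqVlt ltnS => /orP[/eqP ->|le].
  by rewrite neq_ltn ltnSn addn1.
have -> : mu (cone X) = mu X by apply/eqP; rewrite eqn_leq le mu_cone_ge.
by rewrite eqxx addn0.
Qed.

End Cone.

(** * Matching number of the corona *)

Section MuCorona.
Variables (H : sgraph) (X : H -> sgraph).
Local Notation G := (corona X).
Local Notation F := [set v : H | mu (X v) == mu (cone (X v))].
Local Notation base := (@base H X).

Let fbase (x : induced F) : G := base (val x).

Lemma fbase_inj : injective fbase.
Proof. by move=> x y /base_inj /val_inj. Qed.

Lemma fbase_adj x y : adj (fbase x) (fbase y) = adj x y.
Proof. by []. Qed.

Lemma fbaseE z : (z \in fbase @: [set: induced F]) =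
  (z == base (home z)) && (home z \in F).
Proof.
apply/imsetP/andP => [[[u uF] _ ->] //|[/eqP -> zF]].
by exists (exist _ (home z) zF).
Qed.

Lemma mu_corona_ge : mu (induced F) + \sum_v mu (cone (X v)) <= mu G.
Proof.
have [N [mN <- sN]] := mu_embed_witness fbase_inj fbase_adj.
have coverNP z : z \in cover N -> z = base (home z) /\ home z \in F.
  case/bigcupP=> e /sN/subsetP se /se.
  by rewrite fbaseE => /andP[/eqP].
(* The region left to the cone of [v] once the vertices covered by the matching [N] of [H[F]] are
   removed. *)
pose A v := [set z : G | (home z == v) && (z \notin cover N)].
have /fin_all_exists[M MP] v : exists M : {set {set G}},
  [/\ matching M, #|M| = mu (cone (X v)) & {in M, forall e : {set G}, e \subset A v}].
  (* If [N] covers [v], then [v] is in [F], and a maximum matching of [X v], which avoids [v], has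
     the size required for the cone. *)
  have [vN|vN] := boolP (base v \in cover N).
    have [_ vF] := coverNP _ vN.
    have [M [mM eM sM]] := mu_embed_witness (@leaf_inj _ X v) (@leaf_adj _ X v).
    exists M; split=> //; first by move: vF; rewrite inE eM => /eqP.
    move=> e /sM/subsetP se; apply/subsetP => z /se; rewrite leafE inE.
    case/andP => /eqP zv; rewrite zv eqxx; apply: contraNN.
    by case/coverNP => ->; rewrite zv.
  (* Otherwise the whole cone is free, because [N] covers only vertices of [H]. *)
  have [M [mM eM sM]] :=
    mu_embed_witness (@cone_in_inj _ X v) (@cone_in_adj _ X v).
  exists M; split=> // e /sM/subsetP se; apply/subsetP => z /se.
  rewrite cone_inE inE => /eqP zv; rewrite zv eqxx; apply: contraNN vN => zN.
  by have [ez _] := coverNP _ zN; rewrite -zv -ez.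
pose A' i := if i is Some v then A v else cover N.
pose M' i := if i is Some v then M v else N.
have -> : #|N| + \sum_v mu (cone (X v)) = \sum_i #|M' i|.
  by rewrite sum_option /=; congr (_ + _); apply: eq_bigr => v _; case: (MP v).
apply: (leq_sum_mu (A := A')).
- move=> [u|] [v|] z //=; rewrite ?inE.
  + by case/andP=> /eqP <- _ /andP[/eqP <-].
  + by case/andP=> _ /negP.
  + by move=> zN; rewrite zN andbF.
- by case=> [v|] //=; case: (MP v).
- case=> [v|] /=; first by case: (MP v).
  by move=> e eN; apply: bigcup_sup.
Qed.

Lemma mu_corona_le : mu G <= mu (induced F) + \sum_v mu (cone (X v)).
Proof.
have [M mM <-] := mu_witness G; have tM := matching_trivIset mM.
pose MF := [set e in M | e \subset fbase @: [set: induced F]].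
(* The edges inside [H] with at least one end outside [F]; they will be charged to the vertices of
   [B]. *)
pose MH := [set e in M | e \subset base @: [set: H]] :\: MF.
pose P v := [set e in M | e \subset @cone_in H X v @: [set: cone (X v)]].
pose B := [set v | (v \notin F) && (base v \in cover MH)].
have MF_le : #|MF| <= mu (induced F).
  apply: (leq_mu_embed fbase_inj fbase_adj).
    by apply: matchingS mM; apply: subset_setId.
  by move=> e; rewrite inE => /andP[].
have sMH : MH \subset M.
  by apply/subsetP => e /setDP[]; rewrite inE => /andP[].
have MH_le : #|MH| <= #|B|.
  rewrite -(card_imset (mem B) (@base_inj _ X)).
  apply: card_trivIset_meets; first exact: trivIsetS tM.
  move=> e eMH; have /setDP[] := eMH; rewrite !inE => /andP[-> /subsetP se] /=.
  case/subsetPn => z ze; rewrite fbaseE.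
  have := se z ze; rewrite baseE => ez; rewrite ez /= => zF.
  exists z => //; rewrite (eqP ez) imset_f // inE zF /=.
  by apply/bigcupP; exists e => //; rewrite -(eqP ez).
have P_le v : #|P v| + (v \in B) <= mu (cone (X v)).
  have mP : matching (P v) by apply: matchingS mM; apply: subset_setId.
  have [|_] := boolP (v \in B); last first.
    rewrite addn0.
    apply: (leq_mu_embed (@cone_in_inj _ X v) (@cone_in_adj _ X v)) => // e.
    by rewrite inE => /andP[].
  rewrite inE => /andP[vF /bigcupP[e' e'MH ve']].
  have -> : mu (cone (X v)) = mu (X v) + 1.
    by rewrite mu_coneE; move: vF; rewrite inE => ->.
  rewrite leq_add2r.
  (* Since [v] is already covered by an edge of [MH], no edge of [P v] can use it, so [P v] is a
     matching of the copy of [X v]. *)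
  apply: (leq_mu_embed (@leaf_inj _ X v) (@leaf_adj _ X v)) => // e.
  rewrite inE => /andP[eM /subsetP se]; apply/subsetP => z ze.
  rewrite leafE -cone_inE se //=; apply/eqP => ez; subst z.
  have ee' := trivIset_meet_eq tM eM (subsetP sMH _ e'MH) ze ve'; subst e'.
  (* [e] lies both in [H] and in the cone of [v], so it would be a loop. *)
  have /setDP[] := e'MH; rewrite inE => /andP[_ /subsetP sH] _.
  have /edgesP[a [b [ab def_e]]] := matching_edge mM eM.
  have eqv x : x \in e -> x = base v.
    move=> xe; have := se x xe; have := sH x xe; rewrite baseE cone_inE.
    by move=> /eqP -> /eqP /= ->.
  have ea : a = base v by apply: eqv; rewrite def_e set21.
  have eb : b = base v by apply: eqv; rewrite def_e set22.
  by rewrite ea eb (@adj_irr G) in ab.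
have sMU : M \subset MF :|: MH :|: \bigcup_v P v.
  apply/subsetP => e eM; rewrite !in_setU.
  have [eF|eF] /= := boolP (e \in MF); first by [].
  have [eH|[v ev]] := corona_edge (matching_edge mM eM).
    by rewrite in_setD eF inE eM eH.
  apply/orP; right; apply/bigcupP; exists v => //; rewrite inE eM /=.
  by apply/subsetP => z ze; rewrite cone_inE ev.
apply: leq_trans (subset_leq_card sMU) _.
apply: leq_trans (leq_card_setU _ _) _.
have le1 : #|MF :|: MH| <= mu (induced F) + #|B|.
  by apply: leq_trans (leq_card_setU _ _) _; apply: leq_add.
apply: leq_trans (leq_add le1 (leq_card_bigcup _)) _.
(* Write [#|B|] as a sum of indicators over the vertices of [H], so that [P_le] applies term by
   term. *)
rewrite -addnA leq_add2l -sum1_card big_mkcond -big_split /=.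
apply: leq_sum => v _; apply: leq_trans (P_le v).
by rewrite addnC; case: (v \in B).
Qed.

End MuCorona.

Theorem theorem2p1 (H : sgraph) (X : H -> sgraph)
    (X_nonempty : forall v : H, 0 < #|X v|) :
  let G := corona X in
  let F := [set v : H | mu (X v) == mu (cone (X v))] in
  [/\ alpha G = \sum_(v : H) alpha (X v),
      mu G = mu (induced F) + \sum_(v : H) mu (cone (X v)) &
      \sum_(v : H) mu (cone (X v)) = \sum_(v : H) mu (X v) + #|[set: H] :\: F|].
Proof.
move=> G F; split.
- by apply/eqP; rewrite eqn_leq alpha_corona_le // alpha_corona_ge.
- by apply/eqP; rewrite eqn_leq mu_corona_le mu_corona_ge.
(* With the cardinality of the complement of [F] written as a sum of indicators, (iii) is [mu_coneE]
   at each vertex. *)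
- rewrite -sum1_card [X in _ = _ + X]big_mkcond -big_split /=.
  by apply: eq_bigr => v _; rewrite {1}mu_coneE !inE; case: eqP.
Qed.
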